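(* If a fibration of $\mathbb{R}^3$ by oriented lines is given by a (real-)analytic unit vector field $V:\mathbb{R}^3\to S^2$, then it is either a $1$-parameter fibration or a skew fibration.
   Context: A fibration of $\mathbb{R}^3$ by oriented lines is given by a unit vector field $V:\mathbb{R}^3\to S^2$ all of whose integral curves are oriented straight lines; these lines are the fibers. The fibration is skew if no two distinct fibers are parallel (parallel as unoriented lines). It is a $1$-parameter fibration if there is a foliation of $\mathbb{R}^3$ by parallel planes $\{P_t\}$ each of which is individually fibered by lines of the fibration (every fiber lies in some $P_t$). *)

(* Defs.v *)
From HB Require Import structures.
From mathcomp Require Export all_boot all_order all_algebra finmap.
From mathcomp Require Export all_classical all_reals all_analysis.
From mathcomp.analysis.showcase Require summability.

Set Implicit Arguments.
Unset Strict Implicit.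
Unset Printing Implicit Defensive.

Export Order.TTheory GRing.Theory Num.Theory.
Export numFieldNormedType.Exports.

Local Open Scope classical_set_scope.
Local Open Scope ring_scope.

(* The normed space structure of 'rV[R]_n carries the sup norm, so the
   Euclidean structure is introduced separately. *)
Definition dotv (R : realType) (n : nat) (u v : 'rV[R]_n) : R :=
  \sum_(i < n) u 0 i * v 0 i.

Definition monom (R : realType) (n : nat) (a : {ffun 'I_n -> nat})
    (h : 'rV[R]_n) : R :=
  \prod_(i < n) h 0 i ^+ a i.

(* Near p, f is the sum of a power series in n variables centered at p. The
   sum over the multi-indices is the limit of the finite partial sums along
   the directed set of finite sets of multi-indices, i.e. convergence is
   unconditional (equivalently, absolute). *)
Definition analytic_at (R : realType) (n : nat) (f : 'rV[R]_n -> R)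
    (p : 'rV[R]_n) : Prop :=
  exists c : {ffun 'I_n -> nat} -> R,
    \forall h \near (0 : 'rV[R]_n),
      summability.partial_sum (fun a => c a * monom a h) @ summability.totally
        --> f (p + h).

Definition analytic (R : realType) (m n : nat) (F : 'rV[R]_m -> 'rV[R]_n) :
    Prop :=
  forall (p : 'rV[R]_m) (j : 'I_n), analytic_at (fun x => F x 0 j) p.

Definition line (R : realType) (n : nat) (p u : 'rV[R]_n) : set 'rV[R]_n :=
  [set p + t *: u | t in [set: R]].

Definition is_line (R : realType) (n : nat) (L : set 'rV[R]_n) : Prop :=
  exists p u : 'rV[R]_n, u != 0 /\ L = line p u.

(* Parallel as unoriented lines; in particular a line is parallel to itself. *)
Definition parallel (R : realType) (n : nat) (L1 L2 : set 'rV[R]_n) : Prop :=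
  exists p q u : 'rV[R]_n, [/\ u != 0, L1 = line p u & L2 = line q u].

Definition integral_curve (R : realType) (V : 'rV[R]_3 -> 'rV[R]_3)
    (g : R -> 'rV[R]_3) : Prop :=
  forall t : R, is_derive t 1 g (V (g t)).

(* The underlying point set of a fiber; its orientation is the direction of
   V along it. *)
Definition fiber (R : realType) (V : 'rV[R]_3 -> 'rV[R]_3)
    (L : set 'rV[R]_3) : Prop :=
  exists2 g : R -> 'rV[R]_3, integral_curve V g & L = range g.

(* Unit vector fields all of whose integral curves are straight lines. The
   second clause says that the fibers cover the space; that distinct fibers
   are disjoint then follows, since the line through a point is directed by
   the value of V there. For continuous V the second clause is automatic, by
   Peano's theorem and the boundedness of V, and nothing is lost by
   considering only the integral curves defined for all times: any other one
   extends to such a curve, by following the fibers through its endpoints. *)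
Definition line_fibration (R : realType) (V : 'rV[R]_3 -> 'rV[R]_3) : Prop :=
  [/\ forall p, dotv (V p) (V p) = 1,
      forall p, exists2 L, fiber V L & L p
    & forall L, fiber V L -> is_line L].

Definition skew (R : realType) (V : 'rV[R]_3 -> 'rV[R]_3) : Prop :=
  forall L1 L2 : set 'rV[R]_3,
    fiber V L1 -> fiber V L2 -> L1 <> L2 -> ~ parallel L1 L2.

Definition plane (R : realType) (nu : 'rV[R]_3) (t : R) : set 'rV[R]_3 :=
  [set x | dotv nu x = t].

(* A foliation of the space by parallel planes consists of all the planes
   with a given normal nu. *)
Definition one_parameter (R : realType) (V : 'rV[R]_3 -> 'rV[R]_3) : Prop :=
  exists2 nu : 'rV[R]_3, nu != 0 &
    (forall t x, plane nu t x ->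
       exists L, [/\ fiber V L, L x & L `<=` plane nu t]) /\
    (forall L, fiber V L -> exists t, L `<=` plane nu t).

(* Main.v *)
Require Import Defs.
From mathcomp Require Import ring lra.

(** If the fibration is not skew, two distinct fibers, through k1 and k2 say,
    are both parallel to some u. Call a point x along when V x is parallel to u.
    Along points form a union of lines parallel to u, each of which is a fiber.
    For k along, put chi k x = det (u, V x, x - k). If x is not along, then chi k x is nonzero:
    otherwise x - k would lie in the plane spanned by u and V x, and the fiber
    through x would meet the fiber through k (chi_neq0). Moreover chi k is
    constant along each fiber, and by continuity of V its sign is constant along
    each line parallel to u.

    Project the space along u. The fibers through points that are not along
    become lines of the plane.

    If all these lines are parallel to one another, then V is everywhere
    orthogonal to one fixed vector, which is the normal of the planes of a
    1-parameter fibration (orthogonal_one_parameter).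

    Otherwise two of them, through p and q say, cross. Every third one then
    crosses one of the two, so the sign of chi k at any point that is not along
    is its sign at p (chi_sign). Now consider the line through k1 and k2. It
    cannot consist of along points only, because the fiber through p or the one
    through q would cross it after projection (line_not_along). By analyticity,
    being along fails somewhere between k1 and k2 and also somewhere beyond k2
    (identity_theorem). But k1 and k2 are on the same side of the latter point
    and on different sides of the former, so that chi k1 and chi k2 have the
    same sign at one of the two points and opposite signs at the other. This is
    a contradiction (det_along_parallel).

    Analyticity is used only on straight lines, where it reduces to power series
    in one variable (analytic_line). *)

Set Implicit Arguments.
Unset Strict Implicit.
Unset Printing Implicit Defensive.

Local Open Scope classical_set_scope.
Local Open Scope ring_scope.

(** * Power series in one variable *)

Section power_series.
Variable R : realType.
Implicit Types (b : nat -> R) (f g : R -> R).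

Definition sum_near0 b f : Prop := \forall h \near 0, pseries b h @ \oo --> f h.

Definition power_germ f (s : R) : Prop :=
  exists b, sum_near0 b (fun h => f (s + h)).

Lemma pseries_at0 b : pseries b 0 @ \oo --> b 0%N.
Proof.
rewrite -cvg_shiftS /=; apply: cvg_near_cst; apply: nearW => n.
rewrite /pseries /series /= big_nat_recl// expr0 mulr1 big1 ?addr0// => i _.
by rewrite exprS mul0r mulr0.
Qed.

Lemma sum_near0_at0 b f : sum_near0 b f -> f 0 = b 0%N.
Proof.
by move=> /nbhs_singleton bf; exact: (cvg_unique _ bf (@pseries_at0 b)).
Qed.

(** The case h = 0 is apart because the value of the shifted series there is
    b 1, which the quotient does not give. *)
Lemma sum_near0_shift b f : sum_near0 b f ->
  sum_near0 (fun n => b n.+1)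
    (fun h => if h == 0 then b 1%N else (f h - b 0%N) / h).
Proof.
move=> bf; near=> h; have bfh : pseries b h @ \oo --> f h by near: h; exact: bf.
case: eqP => [->|/eqP h0]; first exact: (@pseries_at0 (fun n => b n.+1)).
have -> : pseries (fun n => b n.+1) h = fun n => (pseries b h n.+1 - b 0%N) / h.
  apply/funext => n; rewrite /pseries /series /= big_nat_recl// expr0 mulr1.
  rewrite [b 0%N + _]addrC addrK mulr_suml; apply: eq_bigr => i _.
  by rewrite exprS; field.
apply: cvgM; last exact: cvg_cst.
apply: cvgB; last exact: cvg_cst.
by rewrite (@cvg_shiftS _ (pseries b h)).
Unshelve. all: by end_near. Qed.

(** If the series converges at r / 2, its terms there are bounded by some M, and
    at radius r / 4 it is dominated by M times the geometric series of ratio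
    1 / 2. *)
Lemma sum_near0_bounded b f : sum_near0 b f ->
  exists M, \forall h \near 0, `|f h| <= M.
Proof.
move=> bf; have [r /= r0 bfr] := bf.
have : cvgn (series (fun k => b k * (r / 2) ^+ k)).
  apply/cvg_ex; exists (f (r / 2)); apply: bfr => /=.
  by rewrite sub0r normrN gtr0_norm; lra.
move=> /cvg_series_cvg_0 c0.
have /cvg_seq_bounded[M [_ /(_ (M + 1))]] := (cvgP _ c0).
rewrite ltrDl ltr01 => /(_ isT) Mb.
exists ((M + 1) * 2); near=> h.
have hr : `|h| < r / 4.
  by near: h; apply: (@nbhs0_lt R R); lra.
have fh : pseries b h @ \oo --> f h by near: h; exact: bf.
rewrite -(cvg_lim (@Rhausdorff _) (cvg_norm fh)).
apply: limr_le; first exact: (cvgP _ (cvg_norm fh)).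
have M0 : 0 <= M + 1 by rewrite (le_trans _ (Mb 0%N I)).
suff bound n : `|pseries b h n| <= (M + 1) * (2 - 2 * 2 ^- n).
  near=> n; apply: le_trans (bound n) _; rewrite ler_wpM2l// lerBlDr lerDl.
  by rewrite mulr_ge0 ?invr_ge0 ?exprn_ge0.
rewrite /pseries /series /=.
elim: n => [|n IH]; first by rewrite big_nil normr0 expr0 invr1 mulr1 subrr mulr0.
rewrite big_nat_recr//= (le_trans (ler_normD _ _))//.
have -> : (M + 1) * (2 - 2 * 2 ^- n.+1) =
          (M + 1) * (2 - 2 * 2 ^- n) + (M + 1) * (2 ^- n) :> R.
  by rewrite exprS invfM; move: (2 ^- n) => y; field.
apply: lerD => //.
have -> : b n * h ^+ n = (b n * (r / 2) ^+ n) * (h / (r / 2)) ^+ n.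
  by rewrite -mulrA -exprMn [r / 2 * _]mulrC divfK// lt0r_neq0; lra.
rewrite normrM ler_pM//; first exact: Mb.
rewrite normrX -exprVn; apply: lerXn2r; rewrite ?nnegrE//.
rewrite normrM normfV (@gtr0_norm _ (r / 2)); last by lra.
by rewrite ler_pdivrMr; lra.
Unshelve. all: by end_near. Qed.

(** The quotient (f h - f 0) / h is itself the sum of a power series, hence
    bounded. *)
Lemma sum_near0_cvg b f : sum_near0 b f -> f h @[h --> 0] --> f 0.
Proof.
move=> bf; have [M M_ge] := sum_near0_bounded (sum_near0_shift bf).
have f0 := sum_near0_at0 bf.
apply/cvgrPdist_le => e e0; near=> h.
have [->|h0] := eqVneq h 0; first by rewrite subrr normr0 ltW.
have : `|(f h - b 0%N) / h| <= M.
  suff : `|if h == 0 then b 1%N else (f h - b 0%N) / h| <= M by rewrite (negbTE h0).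
  by near: h.
rewrite normrM normfV ler_pdivrMr ?normr_gt0// distrC f0 => /le_trans; apply.
apply: (@le_trans _ _ ((`|M| + 1) * `|h|)).
  by rewrite ler_wpM2r// (le_trans (ler_norm _))// lerDl.
rewrite mulrC -ler_pdivlMr ?ltr_wpDl//; near: h.
by apply: (@nbhs0_le R R); rewrite divr_gt0// ltr_wpDl.
Unshelve. all: by end_near. Qed.

Lemma sum_near0_neq0 b f : sum_near0 b f -> b 0%N != 0 ->
  \forall h \near 0^', f h != 0.
Proof.
move=> bf b0; have f0 : \forall h \near 0, f h != 0.
  by apply: (cvgr_neq0 _ (sum_near0_cvg bf)); rewrite (sum_near0_at0 bf).
exact: cvg_within f0.
Qed.

(** Divide by h until the constant coefficient is nonzero. *)
Lemma sum_near0_isolated b f m : sum_near0 b f -> b m != 0 ->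
  \forall h \near 0^', f h != 0.
Proof.
elim: m b f => [|m IH] b f bf bm; first exact: (sum_near0_neq0 bf).
have [b0|b0] := eqVneq (b 0%N) 0; last exact: (sum_near0_neq0 bf).
have := IH _ _ (sum_near0_shift bf) bm.
rewrite !near_withinE; apply: filterS => h H h0; have := H h0.
rewrite (negbTE h0) b0 subr0; apply: contraNneq => ->.
by rewrite mul0r.
Qed.

Lemma power_germ_dichotomy f s : power_germ f s ->
  (\forall x \near s, f x = 0) \/ (\forall x \near s^', f x != 0).
Proof.
move=> [b bf]; have [[m bm]|nb] := pselect (exists m, b m != 0); [right|left].
  have := sum_near0_isolated bf bm.
  rewrite !near_withinE => H; apply/(@nbhs0P R R); move: H; apply: filterS => h H.
  by rewrite -subr_eq0 addrC addKr.
have b0 m : b m = 0 by apply: contra_notP nb => /eqP bm; exists m.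
apply/(@nbhs0P R R); apply: filterS bf => h bfh; apply: (cvg_unique _ bfh) => //.
have -> : pseries b h = cst 0; last exact: cvg_cst.
by apply/funext => n; rewrite /pseries /series /= big1// => i _; rewrite b0 mul0r.
Qed.

Lemma power_germ_cvg f s : power_germ f s -> {for s, continuous f}.
Proof.
move=> [b bf]; have := sum_near0_cvg bf; rewrite addr0 => fs.
rewrite /prop_for /continuous_at -[X in _ @[_ --> X] --> _]add0r.
rewrite -cvg_comp_shift.
by have -> : f \o shift s = fun h => f (s + h)
  by apply/funext => h /=; rewrite addrC.
Qed.

(** The set of points near which f vanishes is open, and by the dichotomy
    between local vanishing and isolated zeros it is also closed. *)
Lemma identity_theorem f (x y : R) : (forall s, power_germ f s) -> x < y ->
  (forall s, x < s < y -> f s = 0) -> forall s, f s = 0.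
Proof.
move=> fg xy f0; pose T : set R := [set s | nbhs s [set z | f z = 0]].
suff TT : T = setT by move=> s; have /nbhs_singleton : T s by rewrite TT.
have oT : open T by rewrite openE => s; exact: nbhs_interior.
have cT : closed T.
  (* At a limit point s of T, the zeros of f cannot be isolated. *)
  move=> s clT; have [//|] := power_germ_dichotomy (fg s).
  rewrite near_withinE => fn0; exfalso.
  have [z [Tz fz]] := clT _ fn0.
  have [zs|zs] := eqVneq z s; last first.
    by have := fz zs; rewrite (nbhs_singleton Tz) eqxx.
  move: Tz; rewrite /T zs => Tz.
  have : \forall w \near s^', False.
    rewrite near_withinE; apply: filterS2 fn0 Tz => w fw fw0 ws.
    by have := fw ws; rewrite fw0 eqxx.
  by move=> /filter_ex [].
have : connected [set: R] by apply/connected_intervalP.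
apply.
- exists ((x + y) / 2); rewrite /T /=.
  have : (x + y) / 2 \in `]x, y[ by rewrite in_itv/=; lra.
  move=> /near_in_itvoo; apply: filterS => z; rewrite in_itv /=; exact: f0.
- by exists T => //; rewrite setTI.
- by exists T => //; rewrite setTI.
Qed.

Lemma power_germ0 s : power_germ (fun=> 0 : R) s.
Proof.
exists (fun=> 0); near=> h.
have -> : pseries (fun=> 0 : R) h = cst 0; last exact: cvg_cst.
by apply/funext => n; rewrite /pseries /series /= big1// => i _; rewrite mul0r.
Unshelve. all: by end_near. Qed.

Lemma power_germ_axpy (k : R) f g s :
  power_germ f s -> power_germ g s -> power_germ (fun x => k * f x + g x) s.
Proof.
move=> [b bf] [c cg]; exists (fun n => k * b n + c n).
apply: filterS2 bf cg => h bfh cgh.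
have -> : pseries (fun n => k * b n + c n) h = k \*: pseries b h + pseries c h.
  apply/funext => n; rewrite fctE /pseries /series /= scaler_sumr -big_split /=.
  by apply: eq_bigr => i _; rewrite mulrDl -mulrA.
by apply: cvgD cgh; apply: cvgZr.
Qed.

Lemma power_germ_neq0_sign f x y : (forall s, power_germ f s) ->
  (forall s, f s != 0) -> 0 < f x * f y.
Proof.
move=> fg fn0; wlog xy : x y / x <= y.
  by move=> H; have [/H//|/ltW/H] := leP x y; rewrite mulrC.
have [//|fxy] := ltP 0 (f x * f y).
have [||z _ fz0] := @IVT R f x y 0 xy.
- by apply: continuous_subspaceT => z; exact: power_germ_cvg.
- rewrite ge_min le_max; have := fn0 x; have := fn0 y; nra.
- by have := fn0 z; rewrite fz0 eqxx.
Qed.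

End power_series.

(** * Restriction of analytic functions to lines *)

Section restriction_to_lines.
Variables (R : realType) (n : nat).
Implicit Types (a : {ffun 'I_n -> nat}) (p d : 'rV[R]_n).

Definition mdegree a : nat := (\sum_i a i)%N.

Lemma monom_scale a d (t : R) : monom a (t *: d) = monom a d * t ^+ mdegree a.
Proof.
rewrite /monom /mdegree -prodrXr -big_split /=; apply: eq_bigr => i _.
by rewrite mxE exprMn mulrC.
Qed.

Definition low_degree (N : nat) : {fset {ffun 'I_n -> nat}} :=
  (* the exponents of a multi-index of degree < N are < N *)
  [fset a in [seq [ffun i => val (g i)] | g : {ffun 'I_n -> 'I_N}] |
    (mdegree a < N)%N]%fset.

Lemma mem_low_degree N a : (a \in low_degree N) = (mdegree a < N)%N.
Proof.
rewrite !inE /=; apply: andb_idl => aN.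
have lt_a i : (a i < N)%N.
  by apply: leq_ltn_trans aN; rewrite /mdegree (bigD1 i)//= leq_addr.
apply/mapP; exists [ffun i => Ordinal (lt_a i)].
  by rewrite mem_enum.
by apply/ffunP => i; rewrite !ffunE.
Qed.

(** Every finite set of multi-indices has bounded degree, so an unconditional
    sum over multi-indices can be computed by increasing total degree. *)
Lemma low_degree_cofinal : low_degree N @[N --> \oo] --> summability.totally.
Proof.
move=> B [J _ JB].
exists (\max_(c <- J) mdegree c).+1 => // N /= ltN.
apply: JB; apply/fsubsetP => a aJ; rewrite mem_low_degree.
by apply: leq_ltn_trans ltN; exact: leq_bigmax_seq.
Qed.

Lemma sum_low_degree (F : {ffun 'I_n -> nat} -> R) N :
  summability.partial_sum F (low_degree N) =
  \sum_(0 <= k < N) \sum_(a <- low_degree k.+1 | mdegree a == k) F a.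
Proof.
rewrite /summability.partial_sum -(big_seq_fsetE _ _ xpredT F) /=.
elim: N => [|N IH].
  by rewrite big_nil big_seq big1// => a; rewrite mem_low_degree.
rewrite big_nat_recr//= -IH (bigID (fun a => mdegree a == N)) /= addrC.
congr (_ + _); rewrite -[LHS]big_filter; apply: perm_big; apply: uniq_perm.
- by rewrite filter_uniq// fset_uniq.
- exact: fset_uniq.
- by move=> a; rewrite mem_filter !mem_low_degree ltnS ltn_neqAle.
Qed.

(** Since monom a (t *: d) = monom a d * t ^+ mdegree a, collecting the terms of
    the same total degree turns the series in n variables into a series in t. *)
Lemma analytic_at_line (f : 'rV[R]_n -> R) p d s :
  analytic_at f (p + s *: d) -> power_germ (fun t => f (p + t *: d)) s.
Proof.
move=> [c cf].
exists (fun k => \sum_(a <- low_degree k.+1 | mdegree a == k) c a * monom a d).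
have t0 : t *: d @[t --> (0 : R)] --> (0 : 'rV[R]_n).
  rewrite -[X in _ --> X](scale0r d).
  by apply: cvgZl; exact: cvg_id.
have ct0 : \forall t \near (0 : R),
    summability.partial_sum (fun a => c a * monom a (t *: d))
      @ summability.totally --> f (p + s *: d + t *: d).
  exact: t0 _ cf.
rewrite /sum_near0; near=> t.
have ct : summability.partial_sum (fun a => c a * monom a (t *: d))
    @ summability.totally --> f (p + s *: d + t *: d) by near: t.
rewrite scalerDl addrA.
have := cvg_comp _ _ low_degree_cofinal ct; apply: cvg_trans.
apply: near_eq_cvg; apply: nearW => N /=.
rewrite sum_low_degree /pseries /series /=; apply: eq_bigr => k _.
rewrite mulr_suml; apply: eq_bigr => a /eqP <-.
by rewrite monom_scale mulrA.
Unshelve. all: by end_near. Qed.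

Lemma analytic_line m (F : 'rV[R]_n -> 'rV[R]_m) (w : 'rV[R]_m) p d s :
  analytic F -> power_germ (fun t => dotv w (F (p + t *: d))) s.
Proof.
move=> Fan; rewrite /dotv.
elim: (index_enum _) => [|i r IH].
  by under eq_fun do rewrite big_nil; exact: power_germ0.
under eq_fun do rewrite big_cons.
by apply: power_germ_axpy => //; apply: (@analytic_at_line (fun x => F x 0 i)).
Qed.

End restriction_to_lines.

(** * Cross product and triple product *)

Section vectors.
Variable R : realType.
Implicit Types (u v w a b c : 'rV[R]_3) (k : R).

Definition crossv u v : 'rV[R]_3 :=
  \row_j [:: u 0 1 * v 0 2 - u 0 2 * v 0 1;
             u 0 2 * v 0 0 - u 0 0 * v 0 2;
             u 0 0 * v 0 1 - u 0 1 * v 0 0]`_j.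

Definition det3 a b c : R := dotv (crossv a b) c.

Lemma rV3P u v : u 0 0 = v 0 0 -> u 0 1 = v 0 1 -> u 0 2 = v 0 2 -> u = v.
Proof.
move=> e0 e1 e2; apply/rowP => -[[|[|[|//]]] i].
- by rewrite (_ : Ordinal i = 0)//; exact: val_inj.
- by rewrite (_ : Ordinal i = 1)//; exact: val_inj.
- by rewrite (_ : Ordinal i = 2)//; exact: val_inj.
Qed.

Lemma dotvE u v : dotv u v = u 0 0 * v 0 0 + u 0 1 * v 0 1 + u 0 2 * v 0 2.
Proof.
rewrite /dotv !big_ord_recl big_ord0 addr0 addrA.
by congr (_ + _ * _ + _ * _); congr (_ 0 _); exact: val_inj.
Qed.

Lemma dotvDr u v w : dotv u (v + w) = dotv u v + dotv u w.
Proof. by rewrite !dotvE !mxE; ring. Qed.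

Lemma dotvZr u k v : dotv u (k *: v) = k * dotv u v.
Proof. by rewrite !dotvE !mxE; ring. Qed.

Lemma dotvZl u k v : dotv (k *: u) v = k * dotv u v.
Proof. by rewrite !dotvE !mxE; ring. Qed.

Lemma dotvv_gt0 u : u != 0 -> 0 < dotv u u.
Proof.
move=> u0; rewrite lt_neqAle dotvE -!expr2 !addr_ge0 ?sqr_ge0// andbT eq_sym.
apply: contraNneq u0; move/eqP.
rewrite !paddr_eq0 ?addr_ge0 ?sqr_ge0// !sqrf_eq0 => /andP[/andP[]] /eqP? /eqP? /eqP?.
by apply/eqP; apply: rV3P; rewrite mxE.
Qed.

Let coords := (dotvE, mxE).

Lemma crossv_crossv u v :
  crossv u (crossv u v) = dotv u v *: u - dotv u u *: v.
Proof. by apply: rV3P; rewrite !coords /= ?coords /=; ring. Qed.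

Lemma crossv0 u : crossv u 0 = 0.
Proof. by apply: rV3P; rewrite !mxE /= ?mxE; ring. Qed.

Lemma crossvv u k : crossv u (k *: u) = 0.
Proof. by apply: rV3P; rewrite !mxE /= ?mxE; ring. Qed.

Lemma crossv_eq0 u v : u != 0 -> crossv u v = 0 ->
  v = (dotv u v / dotv u u) *: u.
Proof.
move=> u0 uv0; have uu := lt0r_neq0 (dotvv_gt0 u0).
have := crossv_crossv u v; rewrite uv0 crossv0 => /esym/subr0_eq uvu.
by apply: (scalerI uu); rewrite -uvu scalerA mulrCA divff// mulr1.
Qed.

Lemma det3_cycle a b c : det3 a b c = det3 b c a.
Proof. by rewrite /det3 !coords /=; ring. Qed.

Lemma det3_addl a b c k : det3 a b (c + k *: a) = det3 a b c.
Proof. by rewrite /det3 !coords /=; ring. Qed.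

Lemma det3_addr a b c k : det3 a b (c + k *: b) = det3 a b c.
Proof. by rewrite /det3 !coords /=; ring. Qed.

Lemma det3_cramer a b c w :
  det3 a b c *: w = det3 w b c *: a + det3 a w c *: b + det3 a b w *: c.
Proof. by apply: rV3P; rewrite /det3 !coords /= ?coords /=; ring. Qed.

(** The product a x b completes a and b to a basis, in which w has
    (a x b)-coordinate proportional to det3 a b w. *)
Lemma det3_eq0 a b w : crossv a b != 0 -> det3 a b w = 0 ->
  exists x y, w = x *: a + y *: b.
Proof.
move=> ab0 abw0; have nn := lt0r_neq0 (dotvv_gt0 ab0).
have := det3_cramer a b (crossv a b) w.
rewrite abw0 scale0r addr0 => /(congr1 (fun z => (det3 a b (crossv a b))^-1 *: z)).
rewrite scalerA mulVf// scale1r scalerDr !scalerA => ->.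
by do 2!eexists.
Qed.

(** Modulo u, two independent vectors are not both parallel to a nonzero one. *)
Lemma det3_neq0_exchange u a b w : det3 u a b != 0 -> crossv u w != 0 ->
  det3 u w a != 0 \/ det3 u w b != 0.
Proof.
move=> uab uw; have [uwa|] := eqVneq (det3 u w a) 0; last by left.
right; apply: contra_neq uw => uwb; apply: (scalerI uab); rewrite scaler0.
have uaw : det3 u a w = 0 by rewrite -oppr0 -uwa /det3 !coords /=; ring.
have := det3_cramer u a b w; rewrite uwb uaw !scale0r !addr0 => uabw.
by rewrite -(crossvv u (det3 w a b)) -uabw; apply: rV3P; rewrite !mxE /= ?mxE; ring.
Qed.

(** In the quotient by u, which is a plane, two lines that are not parallel
    meet. *)
Lemma lines_meet_modulo u a b x y : det3 u a b != 0 ->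
  exists r s t, x + s *: a + r *: u = y + t *: b.
Proof.
move=> uab; have := det3_cramer u a b (y - x).
move=> /(congr1 (fun z => (det3 u a b)^-1 *: z)).
rewrite scalerA mulVf// scale1r !scalerDr !scalerA.
set r := _^-1 * _; set s := _^-1 * _; set t := _^-1 * _ => yx.
exists r, s, (- t); apply/eqP; rewrite eq_sym scaleNr subr_eq; apply/eqP.
transitivity (x + (y - x)); first by rewrite addrC subrK.
by rewrite yx !addrA [x + r *: u + _]addrAC.
Qed.

Lemma orthogonal_neq0 u : exists2 v, v != 0 & dotv v u = 0.
Proof.
pose v : 'rV[R]_3 := \row_j [:: - u 0 1; u 0 0; 0]`_j.
have [v0|v0] := eqVneq v 0; last first.
  by exists v => //; rewrite /v !coords /=; ring.
exists (delta_mx 0 0).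
  by apply/eqP => /rowP/(_ 0); rewrite !mxE /= => /eqP; rewrite oner_eq0.
have /rowP/(_ 1) := v0; rewrite !mxE /= => u00.
by rewrite !coords /= u00; ring.
Qed.

End vectors.

(** * Fibers *)

Section fibers.
Variables (R : realType) (V : 'rV[R]_3 -> 'rV[R]_3).
Hypotheses (V_analytic : analytic V) (V_fib : line_fibration V).
Implicit Types (p q u w x y k : 'rV[R]_3) (L : set 'rV[R]_3).

Lemma V_unit x : dotv (V x) (V x) = 1.
Proof. by case: V_fib. Qed.

Lemma V_neq0 x : V x != 0.
Proof.
apply/eqP => V0; have := V_unit x; rewrite V0 dotvE !mxE !mulr0 !addr0.
by move/esym/eqP; rewrite oner_eq0.
Qed.

(** The difference quotients of g are multiples of u, so their limit is. *)
Lemma derive_in_line (g : R -> 'rV[R]_3) p u (t : R) w :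
  (forall s, line p u (g s)) -> is_derive t 1 g w -> crossv u w = 0.
Proof.
move=> gL [dg <-]; set D := 'D_1 g t.
pose q h := h^-1 *: (g (h *: (1 : R) + t) - g t).
have qD : q h @[h --> 0^'] --> D := dg.
have qu h i j : u 0 i * q h 0 j = u 0 j * q h 0 i.
  have [a _ ga] := gL (h *: (1 : R) + t); have [b _ gb] := gL t.
  by rewrite /q -ga -gb !mxE; ring.
have cq (i j : 'I_3) : u 0 i * q h 0 j @[h --> 0^'] --> u 0 i * D 0 j.
  apply: cvgM; first exact: cvg_cst.
  exact: (@cvg_comp _ _ _ _ (fun M : 'rV[R]_3 => M 0 j) _ _ _ qD
            (@coord_continuous _ _ _ 0 j D)).
have H i j : u 0 i * D 0 j = u 0 j * D 0 i.
  have := cq j i; under eq_fun do rewrite -qu.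
  by move=> /(cvg_unique _ (cq i j)) ->.
by apply: rV3P; rewrite !mxE /=; apply/eqP; rewrite subr_eq0; apply/eqP; exact: H.
Qed.

(** On a fiber directed by u, V is a multiple of u of norm 1; its sign relative
    to u is constant because V is continuous. *)
Lemma fiber_line L p : fiber V L -> L p ->
  L = line p (V p) /\ forall x, L x -> V x = V p.
Proof.
move=> fL Lp; have [_ _ lineL] := V_fib; have [e [u [u0 Lou]]] := lineL L fL.
have [g gV Lg] := fL.
have Vu x : L x -> V x = (dotv u (V x) / dotv u u) *: u.
  rewrite Lg => -[t _ <-]; apply: crossv_eq0 => //.
  apply: (@derive_in_line g e u t) => // s.
  by rewrite -Lou Lg; exists s.
pose c s := dotv u (V (e + s *: u)).
have Los s : L (e + s *: u) by rewrite Lou; exists s.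
have uu := dotvv_gt0 u0; have uun := lt0r_neq0 uu.
have c2 s : c s ^+ 2 = dotv u u.
  have := V_unit (e + s *: u); rewrite (Vu _ (Los s)) -/(c s).
  rewrite dotvZr dotvZl => H.
  apply: (mulfI (invr_neq0 uun)); rewrite mulVf// -H.
  by rewrite -mulrA divfK// expr2 mulrCA mulrA.
have c0 s : c s != 0 by rewrite -sqrf_eq0 c2.
have cst s t : c s = c t.
  have ct : 0 < c s * c t.
    apply: (@power_germ_neq0_sign _ c) => // r; exact: analytic_line.
  have /eqP := c2 s; rewrite -(c2 t) eqf_sqr => /orP[/eqP//|/eqP cN].
  by exfalso; move: ct; rewrite cN mulNr -expr2 oppr_gt0 ltNge sqr_ge0.
have VL x y : L x -> L y -> V x = V y.
  move=> Lx Ly; rewrite (Vu _ Lx) (Vu _ Ly).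
  by move: Lx Ly; rewrite Lou => -[s _ <-] [t _ <-]; rewrite -!/(c _) (cst s t).
split; last by move=> x Lx; exact: VL.
move: (Lp); rewrite Lou => -[s _ ps].
have Vp : V p = (c s / dotv u u) *: u by rewrite (Vu _ Lp) /c ps.
rewrite Vp -ps; set k := _ / _.
have k0 : k != 0 by rewrite mulf_neq0 ?invr_eq0.
apply/seteqP; split => x [t _ <-].
  by exists ((t - s) / k) => //; rewrite scalerA divfK// -addrA -scalerDl subrKC.
by exists (s + t * k) => //; rewrite scalerA -addrA -scalerDl.
Qed.

Lemma V_flow x t : V (x + t *: V x) = V x.
Proof.
have [_ /(_ x)[L fL Lx] _] := V_fib.
by have [LE] := fiber_line fL Lx; apply; rewrite LE; exists t.
Qed.

Lemma orthogonal_one_parameter w : w != 0 -> (forall x, dotv w (V x) = 0) ->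
  one_parameter V.
Proof.
move=> w0 wV; exists w => //.
have inP L x : fiber V L -> L x -> L `<=` plane w (dotv w x).
  move=> fL Lx; have [-> _] := fiber_line fL Lx.
  by move=> _ [t _ <-]; rewrite /plane /= dotvDr dotvZr wV mulr0 addr0.
split=> [t x <-|L fL].
  by have [_ /(_ x)[L fL Lx] _] := V_fib; exists L; split => //; exact: inP.
have [g gV Lg] := fL; exists (dotv w (g 0)); apply: inP => //.
by rewrite Lg; exists 0.
Qed.

(** * Fibers that are not parallel to a given direction *)

Section direction.
Variable u : 'rV[R]_3.
Hypothesis u0 : u != 0.

Definition along x : Prop := crossv u (V x) = 0.

(** The sign of chi k x tells on which side of k the fiber through x passes,
    after projection along u. *)
Definition chi k x : R := det3 u (V x) (x - k).

Lemma along_shift x s : along x -> V (x + s *: u) = V x.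
Proof.
move=> /(crossv_eq0 u0); set c := _ / _ => Vc.
have c0 : c != 0.
  by apply: contraNneq (V_neq0 x) => c0; rewrite Vc c0 scale0r.
have -> : s *: u = (s / c) *: V x by rewrite Vc scalerA divfK.
exact: V_flow.
Qed.

Lemma not_along_shift x s : ~ along x -> ~ along (x + s *: u).
Proof.
move=> nx ax; apply: nx; have := along_shift (- s) ax.
by rewrite -addrA -scalerDl subrr scale0r addr0 /along => ->.
Qed.

Lemma not_along x : ~ along x -> crossv u (V x) != 0.
Proof. by move=> nx; apply/eqP. Qed.

(** If the determinant vanished, then some point x + t *: V x of the fiber
    through x would lie on the fiber through k, which is parallel to u. *)
Lemma chi_neq0 k x : along k -> ~ along x -> chi k x != 0.
Proof.
move=> ak nx; apply/eqP => /(det3_eq0 (not_along nx))[a [b xk]].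
have e : x + (- b) *: V x = k + a *: u.
  by rewrite -(subrK k x) [in V _]subrK xk scaleNr -addrA [k - _]addrC addrA addrK addrC.
apply: nx; rewrite /along -(V_flow x (- b)) e along_shift//.
Qed.

Lemma chi_flow k x t : chi k (x + t *: V x) = chi k x.
Proof. by rewrite /chi V_flow addrAC det3_addr. Qed.

Lemma chi_shift k x s : along k -> ~ along x -> 0 < chi k x * chi k (x + s *: u).
Proof.
move=> ak nx; pose f t := chi k (x + t *: u).
have fE t : f t = dotv (crossv (x - k) u) (V (x + t *: u)).
  by rewrite /f /chi addrAC det3_addl -det3_cycle.
have := @power_germ_neq0_sign _ f 0 s; rewrite /f scale0r addr0; apply => t.
  rewrite (_ : (fun _ => _) = f)// (funext fE); exact: analytic_line.
by apply: chi_neq0 => //; exact: not_along_shift.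
Qed.

(** The projections of the fibers through x and y meet: going from x to y by way
    of the crossing follows two fibers and one line parallel to u. *)
Lemma chi_transfer k x y : along k -> ~ along x -> ~ along y ->
  det3 u (V x) (V y) != 0 -> 0 < chi k x * chi k y.
Proof.
move=> ak nx ny d0.
have [r [s [t e]]] := lines_meet_modulo x y d0.
have nxs : ~ along (x + s *: V x) by rewrite /along V_flow.
by have := chi_shift r ak nxs; rewrite e !chi_flow.
Qed.

(** Through p and q pass two fibers whose projections cross. The projection of
    any other fiber crosses one of the two, so that all points that are not
    along can be connected to p by chi_transfer. *)
Lemma chi_sign k p q x y : det3 u (V p) (V q) != 0 ->
  along k -> ~ along x -> ~ along y -> 0 < chi k x * chi k y.
Proof.
move=> pq ak nx ny.
have qp : det3 u (V q) (V p) != 0.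
  by apply: contra_neq pq => qp; rewrite -oppr0 -qp /det3 !(dotvE, mxE) /=; ring.
have nq : ~ along q.
  by move=> aq; move: qp; rewrite /det3 aq dotvE !mxE !mul0r !addr0 eqxx.
have np : ~ along p.
  by move=> ap; move: pq; rewrite /det3 ap dotvE !mxE !mul0r !addr0 eqxx.
have signp z : ~ along z -> 0 < chi k z * chi k p.
  move=> nz; have [zp|zq] := det3_neq0_exchange pq (not_along nz).
    exact: chi_transfer.
  have := chi_transfer ak nz nq zq; have := chi_transfer ak nq np qp.
  nra.
have := signp _ nx; have := signp _ ny; nra.
Qed.

(** The projection of the fiber through p or of the one through q meets that of
    the line k + s *: d. If the latter consisted of along points, the first
    fiber would meet a fiber parallel to u without being parallel to u. *)
Lemma line_not_along k d p q : det3 u (V p) (V q) != 0 -> crossv u d != 0 ->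
  exists s, ~ along (k + s *: d).
Proof.
move=> pq ud.
have [x dx] : exists x, det3 u d (V x) != 0.
  by have [] := det3_neq0_exchange pq ud; [exists p|exists q].
have [r [s [t e]]] := lines_meet_modulo k x dx.
exists s => aks; move/eqP: dx; apply.
have ax : crossv u (V x) = 0.
  by rewrite -(V_flow x t) -e along_shift.
have -> : det3 u d (V x) = - dotv (crossv u (V x)) d.
  by rewrite /det3 !(dotvE, mxE) /=; ring.
by rewrite ax dotvE !mxE; ring.
Qed.

(** On the line k1 + s *: d through k1 and k2, chi k1 is s * f s and chi k2 is
    (s - 1) * f s for one and the same function f. So the product of the two is
    negative for 0 < s < 1 and positive for s > 1 at points that are not along,
    where by chi_sign its sign cannot change if V p and V q are independent
    modulo u. *)
Lemma det_along_parallel k1 k2 p q : along k1 -> along k2 ->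
  crossv u (k2 - k1) != 0 -> det3 u (V p) (V q) = 0.
Proof.
move=> a1 a2 ud; apply/eqP; apply: contraT => pq; exfalso.
set d := k2 - k1 in ud *; pose c s := k1 + s *: d.
pose f s := dotv (crossv d u) (V (c s)).
have chi1 s : chi k1 (c s) = s * f s.
  by rewrite /chi /f; move: (V _) => v; rewrite /c /det3 !(dotvE, mxE) /=; ring.
have chi2 s : chi k2 (c s) = (s - 1) * f s.
  have -> : k2 = k1 + d by rewrite addrC subrK.
  by rewrite /chi /f; move: (V _) => v; rewrite /c /det3 !(dotvE, mxE) /=; ring.
have fg s : power_germ f s by exact: analytic_line.
have [s0 ns0] := line_not_along k1 pq ud.
have fs0 : f s0 != 0.
  by have := chi_neq0 a1 ns0; rewrite -/(c s0) chi1 mulf_eq0 negb_or => /andP[].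
have escape (x y : R) : x < y -> exists2 s, x < s < y & ~ along (c s).
  move=> xy; apply: contrapT => H; move/eqP: fs0; apply.
  apply: (identity_theorem fg xy) => s xsy.
  have as_ : along (c s) by apply: contrapT => ns; apply: H; exists s.
  have -> : f s = dotv (crossv u (V (c s))) d by rewrite /f !(dotvE, mxE) /=; ring.
  by rewrite as_ dotvE !mxE; ring.
have [s /andP[s_gt0 s_lt1] ns] := escape _ _ ltr01.
have [|t /andP[t_gt1 t_lt2] nt] := escape 1 2; first by lra.
have := chi_sign pq a1 ns nt; have := chi_sign pq a2 ns nt.
rewrite !chi1 !chi2 => h2 h1.
have ff : 0 < f s * f t.
  have st : 0 < s * t by rewrite mulr_gt0//; lra.
  by rewrite -(pmulr_rgt0 _ st) mulrACA.
move: h2; rewrite mulrACA pmulr_lgt0// nmulr_rgt0; first by lra.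
by lra.
Qed.

End direction.

Lemma fiber_line_along p u : u != 0 -> fiber V (line p u) -> along u p.
Proof.
move=> u0 fL; have Lp : line p u p by exists 0; rewrite ?scale0r ?addr0.
have [LE _] := fiber_line fL Lp.
have : line p u (p + u) by exists 1; rewrite ?scale1r.
rewrite LE => -[t _ /addrI tu].
rewrite /along -tu; apply: rV3P; rewrite !mxE /= ?mxE; ring.
Qed.

End fibers.

Unset Implicit Arguments.

(** * Analytic line fibrations *)

Theorem corollary2 (R : realType) (V : 'rV[R]_3 -> 'rV[R]_3)
    (V_analytic : analytic V) (V_fibration : line_fibration V) :
  one_parameter V \/ skew V.
Proof.
have [|nV] := pselect (one_parameter V); [by left|right].
move=> L1 L2 fL1 fL2 L12 [k1 [k2 [u [u0 L1E L2E]]]]; subst L1 L2.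
apply: nV.
have a1 := fiber_line_along V_analytic V_fibration u0 fL1.
have a2 := fiber_line_along V_analytic V_fibration u0 fL2.
have ud : crossv u (k2 - k1) != 0.
  apply: contra_not_neq L12 => /(crossv_eq0 u0); set c := _ / _ => k21.
  have -> : k2 = k1 + c *: u by rewrite -k21 addrC subrK.
  apply/seteqP; split => x [t _ <-].
    by exists (t - c) => //; rewrite -addrA -scalerDl subrKC.
  by exists (c + t) => //; rewrite -addrA -scalerDl.
have det0 p q := det_along_parallel V_analytic V_fibration u0 p q a1 a2 ud.
have [aV|/existsNP[p np]] := pselect (forall x, along V u x).
  have [w w0 wu] := orthogonal_neq0 u.
  apply: (orthogonal_one_parameter V_analytic V_fibration w0) => x.
  by rewrite (crossv_eq0 u0 (aV x)) dotvZr wu mulr0.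
apply: (orthogonal_one_parameter V_analytic V_fibration (w := crossv u (V p))).
  exact/eqP.
by move=> x; exact: det0.
Qed.
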